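(* For a finitely generated free abelian group $M$, let $X(M)$ be the subgroup of $\left(\tfrac12\mathbb{Z}\otimes S^3(M)\right)\oplus\Gamma^3(M)$ generated by the elements $$p,\qquad x^{[3]},\qquad x^{[1]}y^{[1]}z^{[1]},\qquad x^{[2]}y^{[1]}+\frac{x^2y+xy^2}{2}\qquad (p\in S^3(M),\ x,y,z\in M).$$ Then $X$ is a subfunctor of $\left(\tfrac12\mathbb{Z}\otimes S^3\right)\oplus\Gamma^3$, there is an exact sequence of functors (given by the inclusion of $S^3$ and the projection to $\Gamma^3$) $$0\to S^3\to X\to\Gamma^3\to0,$$ and this sequence does not split in the category of functors from finitely generated free abelian groups to abelian groups.
   Context: $S^3$ and $\Gamma^3$ denote the third symmetric and divided power functors over $\mathbb{Z}$; $x^{[k]}$ denotes the $k$'th divided power of $x$, with products taken in the divided power algebra, while $x^2y$ etc. denote products in the symmetric algebra. $\tfrac12\mathbb{Z}$ is the subgroup of $\mathbb{Q}$ generated by $\tfrac12$, and $S^3(M)$ is regarded as a subgroup of $\tfrac12\mathbb{Z}\otimes S^3(M)$. *)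

(* Defs.v *)
From HB Require Import structures.
From mathcomp Require Import all_boot all_algebra.
From mathcomp Require Import generic_quotient ring_quotient.
From mathcomp Require Import finmap.
From mathcomp Require Import monalg.
From mathcomp Require Import boolp.

Set Implicit Arguments.
Unset Strict Implicit.
Unset Printing Implicit Defensive.

Import GRing.Theory.
Local Open Scope quotient_scope.
Local Open Scope ring_scope.

Section Span.
Variables (V : zmodType) (G : V -> Prop).

Inductive in_zspan : V -> Prop :=
| zspan_gen v : G v -> in_zspan v
| zspan_0 : in_zspan 0
| zspan_sub u v : in_zspan u -> in_zspan v -> in_zspan (u - v).

Definition zspan : {pred V} := fun v => `[< in_zspan v >].

Lemma zspanP v : reflect (in_zspan v) (v \in zspan).
Proof. exact: asboolP. Qed.

Fact zspan_zmod_closed : zmod_closed zspan.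
Proof.
by split=> [|u v /zspanP su /zspanP sv]; apply/zspanP; [apply: zspan_0|apply: zspan_sub].
Qed.
HB.instance Definition _ := GRing.isZmodClosed.Build V zspan zspan_zmod_closed.

Record spanned := Spanned { spanned_val : V; spanned_valP : spanned_val \in zspan }.

HB.instance Definition _ := [isSub for spanned_val].
HB.instance Definition _ := [Choice of spanned by <:].
HB.instance Definition _ := [SubChoice_isSubZmodule of spanned by <:].

Definition spanned_gen v (Gv : G v) : spanned := Spanned (introT (zspanP v) (zspan_gen Gv)).

End Span.

Lemma zspan_kill (V W : zmodType) (G : V -> Prop) (f : {additive V -> W}) :
  (forall v, G v -> f v = 0) -> forall v, v \in zspan G -> f v = 0.
Proof.
move=> fG v /zspanP; elim=> [u /fG //||u w _ fu _ fw]; first exact: raddf0.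
by rewrite raddfB fu fw subr0.
Qed.

Lemma eq_on_zspan (V W : zmodType) (G : V -> Prop) (f g : {additive V -> W}) :
  (forall v, G v -> f v = g v) -> forall v, v \in zspan G -> f v = g v.
Proof.
move=> fG v /zspanP; elim=> [u /fG //||u w _ fu _ fw]; first by rewrite !raddf0.
by rewrite !raddfB fu fw.
Qed.

Section SpanMap.
Variables (V W : zmodType) (G : V -> Prop) (H : W -> Prop).
Variable f : {additive V -> W}.

Definition zspan_stable := forall v, v \in zspan G -> f v \in zspan H.

Lemma zspan_stable_gen : (forall v, G v -> H (f v)) -> zspan_stable.
Proof.
move=> fG v /zspanP; elim=> [u /fG Hu||u w _ fu _ fw].
- exact/zspanP/zspan_gen.
- by rewrite raddf0 rpred0.
- by rewrite raddfB rpredB.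
Qed.

Definition spanned_map (fS : zspan_stable) (u : spanned G) : spanned H :=
  Spanned (fS _ (spanned_valP u)).

Lemma spanned_map_is_zmod_morphism fS : zmod_morphism (spanned_map fS).
Proof. by move=> u v; apply: val_inj; rewrite /= !raddfB. Qed.
HB.instance Definition _ fS :=
  GRing.isZmodMorphism.Build (spanned G) (spanned H) (spanned_map fS)
    (spanned_map_is_zmod_morphism fS).

End SpanMap.

Section QuotLift.
Variables (V W : zmodType) (I : zmodClosed V) (f : {additive V -> W}).
Hypothesis fI : forall v, v \in I -> f v = 0.

Lemma quot_lift_pi (v : V) : f (repr (\pi_(Quotient.quot I) v)) = f v.
Proof.
apply/eqP; rewrite -subr_eq0 -raddfB; apply/eqP/fI.
by rewrite Quotient.idealrBE reprK.
Qed.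

Lemma quot_lift_is_zmod_morphism :
  zmod_morphism (fun u : Quotient.quot I => f (repr u)).
Proof.
elim/quotW=> u; elim/quotW=> v.
by rewrite -(raddfB \pi_(Quotient.quot I)) !quot_lift_pi raddfB.
Qed.

End QuotLift.

Section FreeAb.
Variables (K : choiceType) (V : zmodType) (h : K -> V).

(* {malg int[K]} is used as the free abelian group on K. *)
Definition zext (g : {malg int[K]}) : V := \sum_(k <- msupp g) h k *~ g@_k.

Lemma zextEw (d : {fset K}) g : (msupp g `<=` d)%fset ->
  zext g = \sum_(k <- d) h k *~ g@_k.
Proof.
move=> le; rewrite [LHS](big_fset_incl _ le) => //= x xd /mcoeff_outdom ->.
by rewrite mulr0z.
Qed.

Lemma zext_is_zmod_morphism : zmod_morphism zext.
Proof.
move=> g1 g2 /=; pose d := (msupp g1 `|` msupp g2)%fset.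
rewrite !(zextEw (d := d)) ?fsubsetUl ?fsubsetUr ?msuppB_le //.
by rewrite -sumrB; apply: eq_bigr=> k _; rewrite mcoeffB mulrzBr.
Qed.
HB.instance Definition _ :=
  GRing.isZmodMorphism.Build {malg int[K]} V zext zext_is_zmod_morphism.

Lemma zextU k : zext << k >> = h k.
Proof. by rewrite (zextEw msuppU_le) big_seq_fset1 mcoeffUU. Qed.

End FreeAb.

Lemma zext_uniq (K : choiceType) (V : zmodType) (f g : {additive {malg int[K]} -> V}) :
  (forall k, f << k >> = g << k >>) -> f =1 g.
Proof.
move=> fg u; rewrite [u]monalgE !raddf_sum; apply: eq_bigr => k _.
have -> : << u@_k *g k >> = << k >> *~ u@_k.
  by rewrite -[u@_k in LHS]intz raddfMz.
by rewrite !raddfMz fg.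
Qed.

Lemma pi_eq0 (V : zmodType) (I : zmodClosed V) v :
  v \in I -> \pi_(Quotient.quot I) v = 0.
Proof.
move=> Iv; rewrite -[0](pi_zeror (s := Quotient.quot I)).
by apply/eqP; rewrite -Quotient.idealrBE subr0.
Qed.

Section Tensor.
Variables A B : zmodType.

(* A \otimes_Z B is the free abelian group on A * B modulo bilinearity. *)
Variant tensor_rel : {malg int[(A * B)%type]} -> Prop :=
| tensor_relDl a a' b :
    tensor_rel (<< (a + a', b) >> - << (a, b) >> - << (a', b) >>)
| tensor_relDr a b b' :
    tensor_rel (<< (a, b + b') >> - << (a, b) >> - << (a, b') >>).

Definition tensor : zmodType := Quotient.quot (zspan tensor_rel).

Definition tens (a : A) (b : B) : tensor := \pi_tensor << (a, b) >>.

Lemma tensDl a a' b : tens (a + a') b = tens a b + tens a' b.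
Proof.
apply/eqP; rewrite -subr_eq0 opprD addrA; apply/eqP; rewrite -!raddfB /=.
by apply/pi_eq0/zspanP/zspan_gen/tensor_relDl.
Qed.

Lemma tensDr a b b' : tens a (b + b') = tens a b + tens a b'.
Proof.
apply/eqP; rewrite -subr_eq0 opprD addrA; apply/eqP; rewrite -!raddfB /=.
by apply/pi_eq0/zspanP/zspan_gen/tensor_relDr.
Qed.

Lemma tensor_uniq (V : zmodType) (f g : {additive tensor -> V}) :
  (forall a b, f (tens a b) = g (tens a b)) -> f =1 g.
Proof.
move=> fg u; rewrite -[u]reprK.
by apply: (zext_uniq (f := f \o \pi_tensor) (g := g \o \pi_tensor)) => -[a b]; apply: fg.
Qed.

End Tensor.

Section TensorMap.
Variables (A B B' : zmodType) (f : {additive B -> B'}).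

Let pre : {malg int[(A * B)%type]} -> tensor A B' :=
  zext (fun ab => tens ab.1 (f ab.2)).

Lemma tensor_map_rel v : v \in zspan (@tensor_rel A B) -> pre v = 0.
Proof.
rewrite /pre; apply: zspan_kill => _ [a a' b|a b b']; rewrite !raddfB /= !zextU /=.
  by rewrite tensDl -addrA -opprD subrr.
by rewrite raddfD tensDr -addrA -opprD subrr.
Qed.

Definition tensor_map (u : tensor A B) : tensor A B' := pre (repr u).

Lemma tensor_mapE a b : tensor_map (tens a b) = tens a (f b).
Proof. exact: etrans (quot_lift_pi tensor_map_rel _) (zextU _ _). Qed.

HB.instance Definition _ :=
  GRing.isZmodMorphism.Build (tensor A B) (tensor A B') tensor_map
    (quot_lift_is_zmod_morphism tensor_map_rel).

End TensorMap.

Definition half_gen (q : rat) : Prop := q = 2%:R^-1.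
Definition halfZ : zmodType := spanned half_gen.
Definition halfZ_half : halfZ := spanned_gen (erefl : half_gen 2%:R^-1).

Fact halfZ_one_subproof : 1 \in zspan half_gen.
Proof.
have -> : 1 = 2%:R^-1 *+ 2 :> rat by [].
by apply: rpredMn; apply/zspanP/zspan_gen.
Qed.
Definition halfZ_one : halfZ := Spanned halfZ_one_subproof.

Section Eval.
Variables (I : choiceType) (R : comNzRingType) (h : I -> R).

Definition meval (m : {cmonom I}) : R := \prod_(i <- finsupp m) h i ^+ m i.

Lemma mevalEw (d : {fset I}) (m : {cmonom I}) : (finsupp m `<=` d)%fset ->
  meval m = \prod_(i <- d) h i ^+ m i.
Proof.
move=> le; rewrite [LHS](big_fset_incl _ le) => //= i _.
by rewrite -cmE_eq0 => /eqP ->; rewrite expr0.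
Qed.

Lemma meval_is_mmorphism : mmorphism meval.
Proof.
split=> [m1 m2|]; last by rewrite /meval mdom1 big_seq_fset0.
rewrite (mevalEw (m := m1) (fsubsetUl _ (finsupp m2))).
rewrite (mevalEw (m := m2) (fsubsetUr (finsupp m1) _)).
rewrite /meval mdomD -big_split /=; apply: eq_bigr => i _.
by rewrite cmM exprD.
Qed.
HB.instance Definition _ :=
  isMultiplicative.Build {cmonom I} R meval meval_is_mmorphism.

(* {malg int[{cmonom I}]} is the polynomial ring over the integers with variables
   indexed by I. *)
Definition peval : {malg int[{cmonom I}]} -> R := mmap intr meval.
HB.instance Definition _ := GRing.RMorphism.on peval.

End Eval.

HB.lock Definition var (I : choiceType) (i : I) : {malg int[{cmonom I}]} := << ucm i >>.

Lemma peval_var (I : choiceType) (R : comNzRingType) (h : I -> R) i :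
  peval h (var i) = h i.
Proof.
by rewrite /peval var.unlock mmapU mul1r /= /meval mdomU big_seq_fset1 cmU eqxx expr1.
Qed.

Lemma peval_uniq (I : choiceType) (R : comNzRingType)
    (f g : {rmorphism {malg int[{cmonom I}]} -> R}) :
  (forall i, f (var i) = g (var i)) -> f =1 g.
Proof.
move=> fg; suff fgm m : f << m >> = g << m >> by exact: (zext_uniq (f := f) (g := g)).
have [n] := ubnP (mdeg m); elim: n m => // n IHn m.
have [->|] := eqVneq m mone; first by rewrite mpolyC1E !rmorph1.
rewrite -mdeg_eq0 => m_neq0 /ltnSE le_mn.
have [i mi] : exists i, i \in finsupp m.
  apply/fset0Pn; apply: contraNneq m_neq0 => m0.
  by rewrite mdegE m0 big_seq_fset0.
have defm : m = mmul (ucm i) (divcm m (ucm i)).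
  apply/eqP/cmP => j; rewrite cmM divcmE cmU; case: eqP => [<-|_] /=.
    by rewrite subnKC // lt0n cmE_neq0.
  by rewrite subn0.
have lt_deg : (mdeg (divcm m (ucm i)) < n)%N.
  by apply: leq_trans le_mn; rewrite [in X in (_ < X)%N]defm mdegM mdegU.
have -> : << m >> = var i * << divcm m (ucm i) >>.
  by rewrite {1}defm malgM_def var.unlock fgmulUU mulr1.
rewrite (rmorphM f) (rmorphM g).
by congr (_ * _); [exact: fg | exact: IHn].
Qed.

(* Commutative rings given by generators pgen and relations r = 0 for r in prel.
   The quotient by an ideal only has a ring structure in the library when the
   ideal is proper, hence the field pproper. *)
Definition in_multiples (R : comNzRingType) (S : R -> Prop) (u : R) : Prop :=
  exists a r, S r /\ u = a * r.

Record presentation := Presentation {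
  pgen : choiceType;
  prel : {malg int[{cmonom pgen}]} -> Prop;
  pproper : 1 \notin zspan (in_multiples prel) }.

Lemma in_multiples_kill (R S : comNzRingType) (G : R -> Prop) (f : {rmorphism R -> S}) :
  (forall r, G r -> f r = 0) -> forall u, u \in zspan (in_multiples G) -> f u = 0.
Proof.
move=> fG; apply: (zspan_kill (f := f)) => _ [a [r [/fG fr ->]]].
by rewrite -[LHS]/(f (a * r)) rmorphM fr mulr0.
Qed.

Lemma in_multiples_mul (R : comNzRingType) (G : R -> Prop) a u :
  u \in zspan (in_multiples G) -> a * u \in zspan (in_multiples G).
Proof.
move=> /zspanP; elim=> [_ [b [r [Gr ->]]]||v w _ Gv _ Gw].
- by apply/zspanP/zspan_gen; exists (a * b), r; rewrite mulrA.
- by rewrite mulr0 rpred0.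
- by rewrite mulrBr rpredB.
Qed.

Section Presented.
Variable P : presentation.

Definition pideal : {pred {malg int[{cmonom (pgen P)}]}} :=
  zspan (in_multiples (@prel P)).

Fact pideal_closed : idealr_closed pideal.
Proof.
split=> [||a u v Pu Pv]; [exact: rpred0 | exact: pproper |].
by apply: rpredD => //; apply: in_multiples_mul.
Qed.
HB.instance Definition _ := isIdealr.Build _ pideal pideal_closed.

Definition presented : comNzRingType := {ideal_quot pideal}.

Definition ppi (u : {malg int[{cmonom (pgen P)}]}) : presented := \pi u.

Lemma ppi_is_zmod_morphism : zmod_morphism ppi.
Proof. exact: raddfB. Qed.
Lemma ppi_is_monoid_morphism : monoid_morphism ppi.
Proof. by split; [exact: rmorph1 | exact: rmorphM]. Qed.
HB.instance Definition _ :=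
  GRing.isZmodMorphism.Build _ presented ppi ppi_is_zmod_morphism.
HB.instance Definition _ :=
  GRing.isMonoidMorphism.Build _ presented ppi ppi_is_monoid_morphism.

Lemma ppi_eq0 u : u \in pideal -> ppi u = 0.
Proof. exact: pi_eq0. Qed.

Lemma ppi_surj u : exists v, u = ppi v.
Proof. by exists (repr u); rewrite /ppi reprK. Qed.

Definition gen (i : pgen P) : presented := ppi (var i).

Variables (R : comNzRingType) (h : pgen P -> R).

Definition compatible := forall r, prel r -> peval h r = 0.

Definition plift (H : compatible) (u : presented) : R := peval h (repr u).

Variable H : compatible.

Lemma plift_pi u : plift H (ppi u) = peval h u.
Proof.
have Hpi v : v \in pideal -> peval h v = 0 by exact: (in_multiples_kill (f := peval h) H).
exact: (quot_lift_pi (f := peval h) Hpi u).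
Qed.

Lemma plift_gen i : plift H (gen i) = h i.
Proof. by rewrite plift_pi peval_var. Qed.

Lemma plift_is_zmod_morphism : zmod_morphism (plift H).
Proof.
move=> x y; have [[u ->] [v ->]] := (ppi_surj x, ppi_surj y).
by rewrite -(raddfB ppi) !plift_pi raddfB.
Qed.

Lemma plift_is_monoid_morphism : monoid_morphism (plift H).
Proof.
split; first by rewrite -(rmorph1 ppi) plift_pi rmorph1.
move=> x y; have [[u ->] [v ->]] := (ppi_surj x, ppi_surj y).
by rewrite -(rmorphM ppi) !plift_pi rmorphM.
Qed.

HB.instance Definition _ :=
  GRing.isZmodMorphism.Build presented R (plift H)
    plift_is_zmod_morphism.
HB.instance Definition _ :=
  GRing.isMonoidMorphism.Build presented R (plift H) plift_is_monoid_morphism.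

End Presented.

Lemma gen_rel (P : presentation) r : @prel P r -> peval (@gen P) r = 0.
Proof.
move=> Pr; rewrite -(peval_uniq (f := @ppi P)) => [|i].
  by apply/ppi_eq0/zspanP/zspan_gen; exists 1, r; rewrite mul1r.
by rewrite /= peval_var.
Qed.

Lemma presented_uniq (P : presentation) (R : comNzRingType)
    (f g : {rmorphism presented P -> R}) :
  (forall i, f (gen i) = g (gen i)) -> f =1 g.
Proof.
move=> fg x; have [u ->] := ppi_surj x.
exact: (peval_uniq (f := f \o @ppi P) (g := g \o @ppi P)).
Qed.

Section SymmetricAlgebra.
Variable M : zmodType.

Variant sym_rel : {malg int[{cmonom M}]} -> Prop :=
| sym_relD x y : sym_rel (@var M (x + y) - @var M x - @var M y).

Lemma sym_rel_aug r : sym_rel r -> peval (fun=> 0 : int) r = 0.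
Proof. by case=> x y; rewrite !rmorphB /= !peval_var. Qed.

Fact sym_proper : 1 \notin zspan (in_multiples sym_rel).
Proof.
apply/negP => /(in_multiples_kill (f := peval (fun=> 0 : int)) sym_rel_aug).
by rewrite rmorph1 => /eqP; rewrite oner_eq0.
Qed.

Definition sym_pres := Presentation sym_proper.

(* sym_var is the inclusion of M as the degree 1 part of Sym(M). *)
Definition symAlg : comNzRingType := presented sym_pres.
Definition sym_var (x : M) : symAlg := @gen sym_pres x.

Lemma sym_varD x y : sym_var (x + y) = sym_var x + sym_var y.
Proof.
apply/eqP; rewrite -subr_eq0 opprD addrA; apply/eqP.
by have := @gen_rel sym_pres _ (sym_relD x y); rewrite !rmorphB /= !peval_var.
Qed.

End SymmetricAlgebra.

Section DividedPowerAlgebra.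
Variable M : zmodType.

Definition div_pvar (x : M) (n : nat) : {malg int[{cmonom (M * nat)%type}]} :=
  @var (M * nat)%type (x, n).

Variant div_rel : {malg int[{cmonom (M * nat)%type}]} -> Prop :=
| div_rel0 x : div_rel (div_pvar x 0 - 1)
| div_relZ a x n : div_rel (div_pvar (x *~ a) n - div_pvar x n *~ (a ^+ n))
| div_relM x m n :
    div_rel (div_pvar x m * div_pvar x n - div_pvar x (m + n) *+ 'C(m + n, m))
| div_relD x y n :
    div_rel (div_pvar (x + y) n
             - \sum_(i < n.+1) div_pvar x i * div_pvar y (n - i)).

Definition div_aug (xn : M * nat) : int := (xn.2 == 0)%:R.

Lemma div_rel_aug r : div_rel r -> peval div_aug r = 0.
Proof.
case=> [x|a x n|x m n|x y n].
- by rewrite rmorphB rmorph1 /= peval_var subrr.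
- rewrite rmorphB rmorphMz /= !peval_var /div_aug /=.
  by case: n => [|n]; rewrite ?expr0 ?subrr // mul0rz subrr.
- rewrite rmorphB rmorphM rmorphMn /= !peval_var /div_aug /= addn_eq0.
  by case: m => [|m]; rewrite ?bin0 ?mul1r ?subrr // mul0r mul0rn subrr.
- rewrite rmorphB rmorph_sum big_ord_recl big1 => [|i _] /=.
    by rewrite rmorphM /= !peval_var /div_aug /= subn0 mul1r addr0 subrr.
  by rewrite rmorphM /= !peval_var /div_aug /= mul0r.
Qed.

Fact div_proper : 1 \notin zspan (in_multiples div_rel).
Proof.
apply/negP => /(in_multiples_kill (f := peval div_aug) div_rel_aug).
by rewrite rmorph1 => /eqP; rewrite oner_eq0.
Qed.

Definition div_pres := Presentation div_proper.

(* div_var x n is the divided power x^[n]. *)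
Definition divAlg : comNzRingType := presented div_pres.
Definition div_var (x : M) (n : nat) : divAlg := @gen div_pres (x, n).

Lemma div_var0 x : div_var x 0 = 1.
Proof.
have := @gen_rel div_pres _ (div_rel0 x).
by rewrite rmorphB rmorph1 /= peval_var => /subr0_eq.
Qed.

Lemma div_varZ a x n : div_var (x *~ a) n = div_var x n *~ (a ^+ n).
Proof.
have := @gen_rel div_pres _ (div_relZ a x n).
by rewrite rmorphB rmorphMz /= !peval_var => /subr0_eq.
Qed.

Lemma div_varM x m n : div_var x m * div_var x n = div_var x (m + n) *+ 'C(m + n, m).
Proof.
have := @gen_rel div_pres _ (div_relM x m n).
by rewrite rmorphB rmorphM rmorphMn /= !peval_var => /subr0_eq.
Qed.

Lemma div_varD x y n :
  div_var (x + y) n = \sum_(i < n.+1) div_var x i * div_var y (n - i).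
Proof.
have := @gen_rel div_pres _ (div_relD x y n).
rewrite rmorphB rmorph_sum /= !peval_var => /subr0_eq E.
rewrite [LHS]E; apply: eq_bigr => i _.
by rewrite rmorphM /= !peval_var.
Qed.

End DividedPowerAlgebra.

Section AlgebraMaps.
Variables (M N : zmodType) (f : {additive M -> N}).

Fact sym_compatible : compatible (P := sym_pres M) (fun x => sym_var (f x)).
Proof.
move=> _ [x y]; rewrite !rmorphB /= !peval_var raddfD sym_varD.
by rewrite -addrA -opprD subrr.
Qed.
Definition symAlg_map : {rmorphism symAlg M -> symAlg N} := plift sym_compatible.

Fact div_compatible :
  compatible (P := div_pres M) (fun xn => div_var (f xn.1) xn.2).
Proof.
move=> _ [x|a x n|x m n|x y n].
- by rewrite rmorphB rmorph1 /= peval_var div_var0 subrr.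
- by rewrite rmorphB rmorphMz /= !peval_var /= raddfMz div_varZ subrr.
- by rewrite rmorphB rmorphM rmorphMn /= !peval_var div_varM subrr.
rewrite rmorphB rmorph_sum /= !peval_var /= raddfD div_varD.
apply/eqP; rewrite subr_eq0; apply/eqP/eq_bigr => i _.
by rewrite rmorphM /= !peval_var.
Qed.
Definition divAlg_map : {rmorphism divAlg M -> divAlg N} := plift div_compatible.

Lemma symAlg_map_var x : symAlg_map (sym_var x) = sym_var (f x).
Proof. exact: (plift_gen sym_compatible). Qed.

Lemma divAlg_map_var x n : divAlg_map (div_var x n) = div_var (f x) n.
Proof. exact: (plift_gen div_compatible). Qed.

End AlgebraMaps.

(* S^d(M) and Gamma^d(M) are the degree d components of Sym(M) and of the
   divided power algebra of M, where x^[n] has degree n. *)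
Section Powers.
Variables (d : nat) (M : zmodType).

Definition sym_monomial (u : symAlg M) : Prop :=
  exists s : d.-tuple M, u = \prod_(x <- s) sym_var x.

Definition symPow : zmodType := spanned sym_monomial.

Definition sym_prod (s : d.-tuple M) : symPow :=
  spanned_gen (ex_intro _ s erefl : sym_monomial (\prod_(x <- s) sym_var x)).

Definition div_monomial (u : divAlg M) : Prop :=
  exists2 s : seq (M * nat), sumn [seq xn.2 | xn <- s] = d &
    u = \prod_(xn <- s) div_var xn.1 xn.2.

Definition divPow : zmodType := spanned div_monomial.

(* An entry (x, n) of s stands for the factor x^[n]. *)
Definition div_prod (s : seq (M * nat)) (ds : sumn [seq xn.2 | xn <- s] = d) : divPow :=
  spanned_gen (ex_intro2 _ _ s ds erefl :
          div_monomial (\prod_(xn <- s) div_var xn.1 xn.2)).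

End Powers.

Section PowerMaps.
Variables (d : nat) (M N : zmodType) (f : {additive M -> N}).

Fact sym_monomial_stable :
  zspan_stable (@sym_monomial d M) (@sym_monomial d N) (symAlg_map f).
Proof.
apply: zspan_stable_gen => _ [s ->]; exists (map_tuple f s).
rewrite big_map; apply: etrans (rmorph_prod (symAlg_map f) _ _ _) _.
by apply: eq_bigr => x _; apply: symAlg_map_var.
Qed.
Definition symPow_map : {additive symPow d M -> symPow d N} :=
  spanned_map sym_monomial_stable.

Fact div_monomial_stable :
  zspan_stable (@div_monomial d M) (@div_monomial d N) (divAlg_map f).
Proof.
apply: zspan_stable_gen => _ [s ds ->].
exists [seq (f xn.1, xn.2) | xn <- s]; first by rewrite -map_comp.
rewrite big_map; apply: etrans (rmorph_prod (divAlg_map f) _ _ _) _.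
by apply: eq_bigr => x _; apply: divAlg_map_var.
Qed.
Definition divPow_map : {additive divPow d M -> divPow d N} :=
  spanned_map div_monomial_stable.

End PowerMaps.

Record fgFree := FgFree {
  fg_carrier :> zmodType;
  fg_basis : exists (n : nat) (b : 'I_n -> fg_carrier),
    forall x, exists! a : {ffun 'I_n -> int}, x = \sum_i b i *~ a i }.

Record abFunctor := AbFunctor {
  fobj :> fgFree -> zmodType;
  fmap : forall M N : fgFree, {additive M -> N} -> {additive fobj M -> fobj N};
  fmap_id : forall (M : fgFree) (u : fobj M), fmap idfun u = u;
  fmap_comp : forall (M N L : fgFree) (g : {additive N -> L}) (f : {additive M -> N})
    (u : fobj M), fmap (g \o f) u = fmap g (fmap f u) }.

Record natTrans (F G : abFunctor) := NatTrans {
  ncomp :> forall M : fgFree, {additive F M -> G M};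
  nat_comm : forall (M N : fgFree) (f : {additive M -> N}) (u : F M),
    ncomp N (fmap F f u) = fmap G f (ncomp M u) }.

Section PowerFunctors.
Variable d : nat.

Fact symPow_map_id (M : zmodType) (u : symPow d M) : symPow_map d idfun u = u.
Proof.
apply: val_inj => /=.
apply: (presented_uniq (f := symAlg_map idfun) (g := idfun)) => x.
exact: symAlg_map_var.
Qed.

Fact symPow_map_comp (M N L : zmodType) (g : {additive N -> L}) (f : {additive M -> N})
  (u : symPow d M) : symPow_map d (g \o f) u = symPow_map d g (symPow_map d f u).
Proof.
apply: val_inj => /=.
apply: (presented_uniq (f := symAlg_map (g \o f)) (g := symAlg_map g \o symAlg_map f)) => x.
rewrite /= [LHS](symAlg_map_var (g \o f)).
by rewrite [symAlg_map f _](symAlg_map_var f) symAlg_map_var.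
Qed.

Definition symF : abFunctor :=
  @AbFunctor (fun M => symPow d M) (fun M N f => symPow_map d f)
    (fun M => @symPow_map_id M) (fun M N L => @symPow_map_comp M N L).

Fact divPow_map_id (M : zmodType) (u : divPow d M) : divPow_map d idfun u = u.
Proof.
apply: val_inj => /=.
apply: (presented_uniq (f := divAlg_map idfun) (g := idfun)) => -[x n].
exact: divAlg_map_var.
Qed.

Fact divPow_map_comp (M N L : zmodType) (g : {additive N -> L}) (f : {additive M -> N})
  (u : divPow d M) : divPow_map d (g \o f) u = divPow_map d g (divPow_map d f u).
Proof.
apply: val_inj => /=.
apply: (presented_uniq (f := divAlg_map (g \o f)) (g := divAlg_map g \o divAlg_map f)) => -[x n].
rewrite /= [LHS](divAlg_map_var (g \o f)).
by rewrite [divAlg_map f _](divAlg_map_var f) divAlg_map_var.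
Qed.

Definition divF : abFunctor :=
  @AbFunctor (fun M => divPow d M) (fun M N f => divPow_map d f)
    (fun M => @divPow_map_id M) (fun M N L => @divPow_map_comp M N L).

End PowerFunctors.

Section TensorFunctor.
Variables (A : zmodType) (F : abFunctor).

Fact tensF_id (M : fgFree) (u : tensor A (F M)) : tensor_map (fmap F idfun) u = u.
Proof.
apply: (tensor_uniq (f := tensor_map (fmap F idfun)) (g := idfun)) => a b.
by rewrite /= tensor_mapE fmap_id.
Qed.

Fact tensF_comp (M N L : fgFree) (g : {additive N -> L}) (f : {additive M -> N})
    (u : tensor A (F M)) :
  tensor_map (fmap F (g \o f)) u = tensor_map (fmap F g) (tensor_map (fmap F f) u).
Proof.
apply: (tensor_uniq (f := tensor_map (fmap F (g \o f)))
  (g := tensor_map (fmap F g) \o tensor_map (fmap F f))) => a b.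
by rewrite /= !tensor_mapE fmap_comp.
Qed.

Definition tensF : abFunctor :=
  @AbFunctor (fun M => tensor A (F M)) (fun M N f => tensor_map (fmap F f))
    tensF_id tensF_comp.

End TensorFunctor.

Section DirectSumFunctor.
Variables F G : abFunctor.

Section Map.
Variables (M N : fgFree) (f : {additive M -> N}).

Definition dsum_map (u : (F M * G M)%type) : (F N * G N)%type :=
  (fmap F f u.1, fmap G f u.2).

Lemma dsum_map_is_zmod_morphism : zmod_morphism dsum_map.
Proof. by move=> u v; rewrite /dsum_map !raddfB. Qed.
HB.instance Definition _ :=
  GRing.isZmodMorphism.Build (F M * G M)%type (F N * G N)%type dsum_map
    dsum_map_is_zmod_morphism.
End Map.

Fact dsum_map_id (M : fgFree) (u : (F M * G M)%type) : dsum_map idfun u = u.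
Proof. by case: u => a b; rewrite /dsum_map !fmap_id. Qed.

Fact dsum_map_comp (M N L : fgFree) (g : {additive N -> L}) (f : {additive M -> N})
  (u : (F M * G M)%type) : dsum_map (g \o f) u = dsum_map g (dsum_map f u).
Proof. by rewrite /dsum_map !fmap_comp. Qed.

Definition dsumF : abFunctor :=
  @AbFunctor (fun M => (F M * G M)%type) (fun M N f => dsum_map f)
    dsum_map_id dsum_map_comp.

End DirectSumFunctor.

Section Subfunctor.
Variables (F : abFunctor) (G : forall M : fgFree, F M -> Prop).

(* It is the subgroups generated by the G(M), not the sets G(M), that are
   required to be stable. *)
Definition is_subfunctor : Prop :=
  forall (M N : fgFree) (f : {additive M -> N}),
    zspan_stable (@G M) (@G N) (fmap F f).

Hypothesis FG : is_subfunctor.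

Fact subF_id (M : fgFree) (u : spanned (@G M)) : spanned_map (FG idfun) u = u.
Proof. by apply: val_inj; apply: fmap_id. Qed.

Fact subF_comp (M N L : fgFree) (g : {additive N -> L}) (f : {additive M -> N})
    (u : spanned (@G M)) :
  spanned_map (FG (g \o f)) u = spanned_map (FG g) (spanned_map (FG f) u).
Proof. by apply: val_inj; apply: fmap_comp. Qed.

Definition subF : abFunctor :=
  @AbFunctor (fun M => spanned (@G M)) (fun M N f => spanned_map (FG f))
    subF_id subF_comp.

End Subfunctor.

Definition short_exact (F G H : abFunctor) (i : natTrans F G) (p : natTrans G H) : Prop :=
  forall M : fgFree,
    [/\ injective (i M),
        forall v, p M v = 0 <-> exists u, i M u = v
      & forall w, exists v, p M v = w].

Definition splits (G H : abFunctor) (p : natTrans G H) : Prop :=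
  exists s : natTrans H G, forall (M : fgFree) (w : H M), p M (s M w) = w.

Definition ambient : abFunctor := dsumF (tensF halfZ (symF 3)) (divF 3).

Definition sym3 (M : zmodType) (x y z : M) : symPow 3 M := sym_prod [tuple x; y; z].

(* p in S^3(M) is identified with 1 \otimes p, and w / 2 is 1/2 \otimes w. *)
Variant X_gen (M : fgFree) : ambient M -> Prop :=
| X_sym (p : symPow 3 M) : X_gen (tens halfZ_one p, 0)
| X_div3 (x : M) : X_gen (0, @div_prod 3 M [:: (x, 3%N)] erefl)
| X_div111 (x y z : M) :
    X_gen (0, @div_prod 3 M [:: (x, 1%N); (y, 1%N); (z, 1%N)] erefl)
| X_div21 (x y : M) :
    X_gen (tens halfZ_half (sym3 x x y + sym3 x y y),
           @div_prod 3 M [:: (x, 2%N); (y, 1%N)] erefl).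

(* Main.v *)
Require Import Defs.
From mathcomp Require Import all_boot all_algebra.
From HB Require Import structures.
From mathcomp Require Import monalg mpoly.

(** An additive map [h] from [M] to a commutative ring of characteristic 2
    extends to a ring homomorphism from the divided power algebra to
    [R[u, v, w] / (u^2, v^2, w^2)] sending [x^[1]], [x^[2]], [x^[3]] to [k u],
    [k v], [k^2 u v], where [k = h x + (h x)^2 w], and the higher divided powers
    to 0. The coefficient of [u v w] vanishes on [x^[3]] and [x^[1] y^[1] z^[1]],
    and on [x^[2] y^[1]] it is [h x ^ 2 * h y + h x * h y ^ 2]. Hence, for (a, b) in
    X(M), the image of the element 2a of S^3(M) in [R] is determined by [b].
    If [b = 0], then 2a vanishes modulo 2 in coordinates, so a is in S^3(M); this
    is exactness in the middle.

    For a section s, let a be the first component of s(e_0^[2] e_1^[1]) over Z^2.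
    The automorphism negating e_1 maps e_0^[2] e_1^[1] to its opposite, so by
    naturality the coefficient of e_0 e_1^2 in 2a is 0, whereas the above makes it
    odd. *)

Set Implicit Arguments.
Unset Strict Implicit.
Unset Printing Implicit Defensive.

Import GRing.Theory.
Local Open Scope ring_scope.

(* The dual numbers: the pair (a, b) stands for a + b e with e^2 = 0. *)
Definition dual (R : comNzRingType) : Type := (R * R)%type.

(** * Dual numbers as a commutative ring *)

Section Dual.
Variable R : comNzRingType.

HB.instance Definition _ := GRing.Zmodule.copy (dual R) (R * R)%type.

Definition dual_mul (x y : dual R) : dual R := (x.1 * y.1, x.1 * y.2 + x.2 * y.1).

Fact dual_mulA : associative dual_mul.
Proof.
move=> [a b] [c d] [e f]; rewrite /dual_mul /= mulrA; congr (_, _).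
by rewrite mulrDl mulrDr !mulrA addrA.
Qed.
Fact dual_mulC : commutative dual_mul.
Proof.
move=> [a b] [c d]; rewrite /dual_mul /= mulrC; congr (_, _).
by rewrite addrC (mulrC b) (mulrC a).
Qed.
Fact dual_mul1 : left_id ((1, 0) : dual R) dual_mul.
Proof. by move=> [a b]; rewrite /dual_mul /= !mul1r mul0r addr0. Qed.
Fact dual_mulD : left_distributive dual_mul +%R.
Proof.
move=> [a b] [c d] [e f]; rewrite /dual_mul /=; congr (_, _); rewrite !mulrDl //.
by rewrite addrACA.
Qed.
Fact dual_oner_neq0 : ((1, 0) : dual R) != 0.
Proof. by apply/eqP => -[/eqP]; rewrite oner_eq0. Qed.

HB.instance Definition _ :=
  GRing.Zmodule_isComNzRing.Build (dual R)
    dual_mulA dual_mulC dual_mul1 dual_mulD dual_oner_neq0.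

Definition Dual (a b : R) : dual R := (a, b).

Lemma dual_mulE a b c d : Dual a b * Dual c d = Dual (a * c) (a * d + b * c).
Proof. by []. Qed.
Lemma dual_addE a b c d : Dual a b + Dual c d = Dual (a + c) (b + d).
Proof. by []. Qed.
Lemma dual_zeroE : 0 = Dual 0 0. Proof. by []. Qed.
Lemma dual_oneE : 1 = Dual 1 0. Proof. by []. Qed.

Lemma dual_mulrzE a b (n : int) : Dual a b *~ n = Dual (a *~ n) (b *~ n).
Proof.
have natE k : Dual a b *+ k = Dual (a *+ k) (b *+ k).
  by elim: k => // k IHk; rewrite !mulrS IHk dual_addE.
by case: n => k; rewrite /intmul natE.
Qed.

Lemma dual_pchar2 : 2 \in [pchar R] -> 2 \in [pchar (dual R)].
Proof.
move=> /andP[_ /eqP R2]; apply/andP; split=> //; apply/eqP.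
by rewrite mulr2n dual_oneE dual_addE -mulr2n R2 addr0.
Qed.

End Dual.

(** * Identities in characteristic 2 *)

Lemma pchar2_addrr (R : comNzRingType) (x : R) : 2 \in [pchar R] -> x + x = 0.
Proof. by move=> /andP[_ /eqP R2]; rewrite -mulr2n -mulr_natr R2 mulr0. Qed.

Lemma pchar2_sqrrD (R : comNzRingType) (x y : R) : 2 \in [pchar R] ->
  (x + y) ^+ 2 = x ^+ 2 + y ^+ 2.
Proof. by move=> R2; rewrite sqrrD mulr2n pchar2_addrr // addr0. Qed.

(** The image of an integer is fixed by the Frobenius endomorphism, so it equals each of its
    positive powers. *)
Lemma pchar2_mulrzX (R : comNzRingType) (z : R) (a : int) n : 2 \in [pchar R] ->
  z *~ (a ^+ n.+1) = z *~ a.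
Proof.
move=> R2; rewrite -[LHS]mulrzr -[RHS]mulrzr rmorphXn /=; congr (_ * _).
suff: (a%:~R : R) ^+ 2 = a%:~R.
  by move=> sq; elim: n => // n IHn; rewrite exprS IHn -expr2.
rewrite -pFrobenius_autE; exact: rmorph_int.
Qed.


(** * Ring homomorphisms from the divided power algebra in characteristic 2 *)

Section DividedPowerLift.
Variables (M : zmodType) (S : comNzRingType) (h : {additive M -> S}).
Hypothesis S2 : 2 \in [pchar S].

(* The inner nilpotent is u, the outer one is v. *)
Definition div_dual (xn : M * nat) : dual (dual S) :=
  let X := h xn.1 in
  match xn.2 with
  | 0 => 1
  | 1 => Dual (Dual 0 X) 0
  | 2 => Dual 0 (Dual X 0)
  | 3 => Dual 0 (Dual 0 (X ^+ 2))
  | _ => 0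
  end.

Let dualE :=
  (dual_zeroE, dual_oneE, dual_mulE, dual_addE, (mul0r, mulr0, addr0, add0r, mulr1, mul1r)).

(** Such a product contains u^2 or v^2, or a divided power of order above 3, which is sent to 0. *)
Lemma div_dual_mul_eq0 x y m n : (3 < m + n)%N -> div_dual (x, m) * div_dual (y, n) = 0.
Proof.
by case: m => [|[|[|[|m]]]]; case: n => [|[|[|[|n]]]] //= _;
  rewrite ?mul0r ?mulr0 //= /div_dual /= !dualE.
Qed.


(** The values are linear in [h x] for [n = 1, 2] and quadratic for [n = 3]; in characteristic 2 all
    positive powers of [a] act like [a]. *)
Lemma div_dualZ a x n : div_dual (x *~ a, n) = div_dual (x, n) *~ (a ^+ n).
Proof.
case: n => [|n]; first by rewrite expr0.
rewrite pchar2_mulrzX; last by do 2 apply: dual_pchar2.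
rewrite /div_dual /= raddfMz.
case: n => [|[|[|n]]] /=; rewrite ?dual_mulrzE ?mul0rz //.
rewrite -[h x *~ a]mulrzr exprMn -rmorphXn /=.
by rewrite mulrzr pchar2_mulrzX.
Qed.

(** For positive [m] and [n] with sum at most 3 the binomial coefficient is 2 or 3. Up to
    coefficients, the first case reads u^2 = 0 = 2v and the second u v = 3 u v. *)
Lemma div_dualM x m n :
  div_dual (x, m) * div_dual (x, n) = div_dual (x, m + n)%N *+ 'C(m + n, m).
Proof.
have [mn|] := ltnP 3 (m + n).
  rewrite div_dual_mul_eq0 //; move: (m + n)%N mn => [|[|[|[|k]]]] // _.
  by rewrite mul0rn.
have E (z : dual (dual S)) : z *+ 2 = 0.
  by rewrite mulr2n pchar2_addrr //; do 2 apply: dual_pchar2.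
case: m => [|m]; first by rewrite bin0 mul1r.
case: n => [|n]; first by rewrite addn0 binn mulr1.
case: m => [|[|m]]; case: n => [|[|n]]; rewrite ?addSn ?addnS // => _.
- by rewrite E /div_dual /= !dualE.
- by rewrite -[X in _ *+ X]/(2 + 1)%N mulrnDr E /div_dual /= !dualE.
- by rewrite -[X in _ *+ X]/(2 + 1)%N mulrnDr E /div_dual /= !dualE.
Qed.

Lemma div_dualD x y n :
  div_dual (x + y, n) = \sum_(i < n.+1) div_dual (x, val i) * div_dual (y, n - i)%N.
Proof.
have [n_gt3|] := ltnP 3 n.
  rewrite big1 => [|i _]; last by rewrite div_dual_mul_eq0 ?subnKC ?leq_ord.
  by case: n n_gt3 => [|[|[|[|n]]]].
case: n => [|[|[|[|n]]]] // _; rewrite !big_ord_recl big_ord0 /div_dual /= /bump /=.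
- by rewrite !dualE.
- by rewrite raddfD !dualE addrC.
- by rewrite raddfD !dualE addrC.
(* For [n = 3] the terms from x^[1] y^[2] and x^[2] y^[1] are both [h x * h y] times u v, and
   cancel. *)
rewrite raddfD pchar2_sqrrD // !dualE /Dual /=.
by rewrite (addrA (h x * h y)) pchar2_addrr // add0r (addrC (h y ^+ 2)).
Qed.

Fact div_dual_compatible : compatible (P := div_pres M) div_dual.
Proof.
move=> _ [x|a x n|x m n|x y n].
- by rewrite rmorphB rmorph1 /= peval_var subrr.
- rewrite rmorphB rmorphMz /= !peval_var div_dualZ; exact: subrr.
- rewrite rmorphB rmorphM rmorphMn /= !peval_var div_dualM; exact: subrr.
rewrite rmorphB rmorph_sum /= !peval_var div_dualD.
apply/eqP; rewrite subr_eq0; apply/eqP/eq_bigr => i _.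
by rewrite rmorphM /= !peval_var.
Qed.
End DividedPowerLift.

Definition div_lift (M : zmodType) (S : comNzRingType) (h : {additive M -> S})
    (S2 : 2 \in [pchar S]) : {rmorphism divAlg M -> dual (dual S)} :=
  plift (div_dual_compatible h S2).

Lemma div_lift_var (M : zmodType) (S : comNzRingType) (h : {additive M -> S})
    (S2 : 2 \in [pchar S]) x n : div_lift h S2 (div_var x n) = div_dual h (x, n).
Proof. exact: (plift_gen (div_dual_compatible h S2)). Qed.

(** * Ring homomorphisms from the symmetric algebra *)

Section SymLift.
Variables (M : zmodType) (R : comNzRingType) (h : {additive M -> R}).

Fact sym_lift_compatible : compatible (P := sym_pres M) h.
Proof.
by move=> _ [x y]; rewrite !rmorphB /= !peval_var raddfD -addrA -opprD subrr.
Qed.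

Definition sym_lift : {rmorphism symAlg M -> R} := plift sym_lift_compatible.

Lemma sym_lift_var x : sym_lift (sym_var x) = h x.
Proof. exact: (plift_gen sym_lift_compatible). Qed.

Lemma sym_lift_prod (s : seq M) : sym_lift (\prod_(x <- s) sym_var x) = \prod_(x <- s) h x.
Proof. by rewrite rmorph_prod; apply: eq_bigr => x _; exact: sym_lift_var. Qed.

Lemma sym_lift_uniq (f : {rmorphism symAlg M -> R}) :
  (forall x, f (sym_var x) = h x) -> f =1 sym_lift.
Proof.
by move=> fh; apply: presented_uniq => x; rewrite [LHS]fh -[LHS]sym_lift_var.
Qed.
End SymLift.

Lemma spanned_val_is_zmod_morphism (V : zmodType) (G : V -> Prop) :
  zmod_morphism (@spanned_val V G).
Proof. by []. Qed.
HB.instance Definition _ (V : zmodType) (G : V -> Prop) :=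
  GRing.isZmodMorphism.Build (spanned G) V (@spanned_val V G)
    (@spanned_val_is_zmod_morphism V G).


(** * Tensor products with the half-integers *)

Section TensBilinear.
Variables A B : zmodType.

Lemma tens_is_zmod_morphism (a : A) : zmod_morphism (@tens A B a).
Proof.
move=> b b'; apply/(addIr (tens a b')).
by rewrite -tensDr !subrK.
Qed.
HB.instance Definition _ (a : A) :=
  GRing.isZmodMorphism.Build B (tensor A B) (@tens A B a) (tens_is_zmod_morphism a).

Definition tensl (b : B) (a : A) := tens a b.
Lemma tensl_is_zmod_morphism b : zmod_morphism (tensl b).
Proof.
move=> a a'; apply/(addIr (tensl b a')).
by rewrite /tensl -tensDl !subrK.
Qed.
HB.instance Definition _ (b : B) :=
  GRing.isZmodMorphism.Build A (tensor A B) (tensl b) (tensl_is_zmod_morphism b).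

Lemma tens_mulrz (a : A) (b : B) (n : int) : tens (a *~ n) b = tens a (b *~ n).
Proof. by rewrite -[LHS]/(tensl b _) raddfMz [RHS]raddfMz. Qed.
End TensBilinear.

Lemma halfZ_int (q : halfZ) : exists n : int, n%:~R == val q *+ 2.
Proof.
case: q => q /= /zspanP; elim=> [_ ->||u v _ [m /eqP mE] _ [n /eqP nE]].
- by exists 1.
- by exists 0.
by exists (m - n); rewrite rmorphB /= mE nE mulrnBl.
Qed.

Fact halfZ_double_subproof : {f : halfZ -> int | forall q, (f q)%:~R = val q *+ 2 :> rat}.
Proof.
by exists (fun q => xchoose (halfZ_int q)) => q; exact/eqP/(xchooseP (halfZ_int q)).
Qed.

Definition halfZ_double : halfZ -> int := sval halfZ_double_subproof.

Lemma halfZ_doubleE q : (halfZ_double q)%:~R = val q *+ 2 :> rat.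
Proof. exact: (svalP halfZ_double_subproof). Qed.

Lemma halfZ_double_half : halfZ_double halfZ_half = 1.
Proof. by apply: (@intr_inj rat); rewrite halfZ_doubleE. Qed.

Lemma halfZ_double_one : halfZ_double halfZ_one = 2.
Proof. by apply: (@intr_inj rat); rewrite halfZ_doubleE. Qed.

Lemma halfZ_half_mulrz q : halfZ_half *~ halfZ_double q = q.
Proof.
apply: val_inj; rewrite (raddfMz val) /= -mulrzr halfZ_doubleE.
by rewrite mulrnAr -mulrnAl -mulr_natr mulVf // mul1r.
Qed.

Lemma halfZ_half2 : halfZ_half *~ 2 = halfZ_one.
Proof. by rewrite -halfZ_double_one halfZ_half_mulrz. Qed.

Lemma halfZ_double_is_zmod_morphism : zmod_morphism halfZ_double.
Proof.
move=> p q; apply: (@intr_inj rat).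
by rewrite rmorphB /= !halfZ_doubleE raddfB mulrnBl.
Qed.
HB.instance Definition _ :=
  GRing.isZmodMorphism.Build halfZ int halfZ_double halfZ_double_is_zmod_morphism.

Section TensorLift.
Variables (A B W : zmodType) (h : A -> B -> W).
Hypothesis hDl : forall b a a', h (a + a') b = h a b + h a' b.
Hypothesis hDr : forall a b b', h a (b + b') = h a b + h a b'.

Let pre : {malg int[(A * B)%type]} -> W := zext (fun ab => h ab.1 ab.2).

Fact tensor_lift_rel v : v \in zspan (@tensor_rel A B) -> pre v = 0.
Proof.
rewrite /pre; apply: zspan_kill => _ [a a' b|a b b']; rewrite !raddfB /= !zextU /=.
  by rewrite hDl -addrA -opprD subrr.
by rewrite hDr -addrA -opprD subrr.
Qed.

(** Taking the two bilinearity proofs as arguments lets an additive structure be attached to the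
    function applied to them. *)
Definition tensor_lift of (forall b a a', h (a + a') b = h a b + h a' b)
    & (forall a b b', h a (b + b') = h a b + h a b') :=
  fun u : tensor A B => pre (repr u).

HB.instance Definition _ :=
  GRing.isZmodMorphism.Build (tensor A B) W (tensor_lift hDl hDr)
    (quot_lift_is_zmod_morphism tensor_lift_rel).

Lemma tensor_liftE a b : tensor_lift hDl hDr (tens a b) = h a b.
Proof. exact: etrans (quot_lift_pi tensor_lift_rel _) (zextU _ _). Qed.
End TensorLift.

Section HalfTensor.
Variable S : zmodType.

Fact double_tensorDl (s : S) p q :
  s *~ halfZ_double (p + q) = s *~ halfZ_double p + s *~ halfZ_double q.
Proof. by rewrite (raddfD halfZ_double) mulrzDr. Qed.

Fact double_tensorDr q (s t : S) :
  (s + t) *~ halfZ_double q = s *~ halfZ_double q + t *~ halfZ_double q.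
Proof. exact: mulrzDl. Qed.

(** [halfZ] is infinite cyclic on [halfZ_half], so tensoring with it gives a copy of [S]. This
    identification is inverse to [tens halfZ_half], and it sends [tens halfZ_one p] to 2p. *)
Definition double_tensor : {additive tensor halfZ S -> S} :=
  tensor_lift (h := fun q s => s *~ halfZ_double q) double_tensorDl double_tensorDr.

Lemma double_tensorE q s : double_tensor (tens q s) = s *~ halfZ_double q.
Proof. exact: tensor_liftE. Qed.

Lemma half_tensorK u : tens halfZ_half (double_tensor u) = u.
Proof.
apply: (tensor_uniq (f := tens halfZ_half \o double_tensor) (g := idfun)) => q s /=.
by rewrite double_tensorE -tens_mulrz halfZ_half_mulrz.
Qed.
End HalfTensor.

Arguments double_tensor {S}.

Lemma double_tensor_map (S S' : zmodType) (f : {additive S -> S'}) u :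
  double_tensor (tensor_map f u) = f (double_tensor u).
Proof.
apply: (tensor_uniq (f := double_tensor \o tensor_map f) (g := f \o double_tensor)) => q s /=.
by rewrite tensor_mapE !double_tensorE raddfMz.
Qed.

Lemma intr_F2_eq0 (n : int) : n%:~R = 0 :> 'F_2 -> exists k : int, n = k *~ 2.
Proof.
move=> n0; exists (n %/ 2)%Z.
have nE := divz_eq n 2; rewrite mulrzz.
have : (n %% 2)%Z%:~R = 0 :> 'F_2.
  move: n0; rewrite {1}nE rmorphD rmorphM /=.
  have -> : (2 : int)%:~R = 0 :> 'F_2 by apply/val_inj.
  by rewrite mulr0 add0r.
have := ltz_pmod n (isT : 0 < 2 :> int); have := modz_ge0 n (isT : 2 != 0 :> int).
by rewrite {4}nE; case: (n %% 2)%Z => [[|[|k]]|k] // _ _ _; rewrite addr0.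
Qed.

(** * The parity invariant linking the two components of X *)

Section Parity.
Variables (M : fgFree) (R : comNzRingType) (h : {additive M -> R}).
Hypothesis R2 : 2 \in [pchar R].

(** The nilpotent here is w. The product of the values at [x] and [y] has w-coefficient
    [h x * h y ^+ 2 + h x ^+ 2 * h y], which is 0 for [x = y] in characteristic 2. *)
Definition add_square (x : M) : dual R := Dual (h x) (h x ^+ 2).

Fact add_square_is_zmod_morphism : zmod_morphism add_square.
Proof.
move=> x y; apply/(addIr (add_square y)); rewrite subrK /add_square dual_addE.
rewrite raddfB subrK; congr (Dual _ _).
by rewrite -pchar2_sqrrD // subrK.
Qed.
HB.instance Definition _ :=
  GRing.isZmodMorphism.Build M (dual R) add_square add_square_is_zmod_morphism.

Definition parity_lift : {rmorphism divAlg M -> dual (dual (dual R))} :=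
  div_lift add_square (dual_pchar2 R2).

(** The projections take the coefficients of v, u and w in turn, from the outermost nilpotent to the
    innermost. *)
Definition div_parity (u : divAlg M) : R := (parity_lift u).2.2.2.

Fact div_parity_is_zmod_morphism : zmod_morphism div_parity.
Proof. by move=> u v; rewrite /div_parity (raddfB parity_lift). Qed.
HB.instance Definition _ :=
  GRing.isZmodMorphism.Build (divAlg M) R div_parity div_parity_is_zmod_morphism.

Lemma div_parity_prod (s : seq (M * nat)) :
  div_parity (\prod_(xn <- s) div_var xn.1 xn.2) =
  (\prod_(xn <- s) div_dual add_square xn).2.2.2.
Proof.
rewrite /div_parity (rmorph_prod parity_lift); do 3 congr (_.2).
by apply: eq_bigr => -[x n] _; exact: div_lift_var.
Qed.

Lemma div_parity3 x : div_parity (\prod_(xn <- [:: (x, 3%N)]) div_var xn.1 xn.2) = 0.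
Proof.
by rewrite div_parity_prod big_seq1 /div_dual /= mulrC pchar2_addrr.
Qed.

Let dualE :=
  (dual_zeroE, dual_oneE, dual_mulE, dual_addE, (mul0r, mulr0, addr0, add0r, mulr1, mul1r)).

(** All three factors are multiples of u, and u^2 = 0. *)
Lemma div_parity111 x y z :
  div_parity (\prod_(xn <- [:: (x, 1%N); (y, 1%N); (z, 1%N)]) div_var xn.1 xn.2) = 0.
Proof.
by rewrite div_parity_prod !big_cons big_nil /div_dual /= /add_square !dualE /=.
Qed.

Lemma div_parity21 x y :
  div_parity (\prod_(xn <- [:: (x, 2%N); (y, 1%N)]) div_var xn.1 xn.2) =
  h x * h x * h y + h x * h y * h y.
Proof.
rewrite div_parity_prod !big_cons big_nil /div_dual /= /add_square !dualE /=.
by rewrite addrC !expr2 !mulrA.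
Qed.

(** Both sides are additive, so generators suffice. For the one with x^[2] y^[1], doubling clears
    the denominator of (x^2 y + x y^2)/2, and [div_parity21] gives the same value. *)
Lemma X_parity (v : ambient M) : v \in zspan (@X_gen M) ->
  sym_lift h (spanned_val (double_tensor v.1)) = div_parity (spanned_val v.2).
Proof.
move=> /zspanP; elim=> [_ [p|x|x y z|x y]||u w _ IHu _ IHw].
(* Doubling gives 2p, which vanishes in characteristic 2; the second component is 0. *)
- rewrite /= double_tensorE halfZ_double_one raddf0.
  rewrite (raddfMz (@spanned_val _ _)) (raddfMz (sym_lift h)).
  exact: pchar2_addrr.
- by rewrite div_parity3 !raddf0.
- by rewrite div_parity111 !raddf0.
- rewrite div_parity21 /= double_tensorE halfZ_double_half mulr1z.
  rewrite (raddfD (@spanned_val _ _)) (raddfD (sym_lift h)).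
  by rewrite /sym3 /= !sym_lift_prod !big_cons !big_nil !mulr1 !mulrA.
- by rewrite !raddf0.
by rewrite /= !raddfB /= IHu IHw.
Qed.
End Parity.

(** * The symmetric algebra of a free module inside a polynomial ring *)

Section FreeSym.
Variables (M : fgFree) (n : nat) (b : 'I_n -> M).
Hypothesis bP : forall x, exists! a : {ffun 'I_n -> int}, x = \sum_i b i *~ a i.

Fact coord_subproof x : exists a : {ffun 'I_n -> int}, x == \sum_i b i *~ a i.
Proof. by have [a [/eqP ax _]] := bP x; exists a. Qed.

Definition coord (x : M) : {ffun 'I_n -> int} := xchoose (coord_subproof x).

Lemma coordE x : x = \sum_i b i *~ coord x i.
Proof. exact/eqP/(xchooseP (coord_subproof x)). Qed.

Lemma coord_uniq x (a : {ffun 'I_n -> int}) : x = \sum_i b i *~ a i -> coord x = a.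
Proof. by have [c [_ cU]] := bP x; move=> /cU <-; rewrite -(cU _ (coordE x)). Qed.

Definition lin_form (x : M) : mpoly n int := \sum_i 'X_i *~ coord x i.

Fact lin_form_is_zmod_morphism : zmod_morphism lin_form.
Proof.
move=> x y; rewrite /lin_form -sumrB; apply: eq_bigr => i _; rewrite -mulrzBr.
have -> // : coord (x - y) = [ffun j => coord x j - coord y j].
  apply: coord_uniq; rewrite {1}[x]coordE {1}[y]coordE -sumrB.
  by apply: eq_bigr => j _; rewrite ffunE mulrzBr.
by rewrite ffunE.
Qed.
HB.instance Definition _ :=
  GRing.isZmodMorphism.Build M (mpoly n int) lin_form lin_form_is_zmod_morphism.

Definition sym_poly : {rmorphism symAlg M -> mpoly n int} := sym_lift lin_form.

Definition poly_sym : mpoly n int -> symAlg M := mmap intr (fun i => sym_var (b i)).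
HB.instance Definition _ := GRing.RMorphism.on poly_sym.

Fact sym_var_is_zmod_morphism : zmod_morphism (@sym_var M).
Proof. by move=> x y; apply/(addIr (sym_var y)); rewrite -sym_varD !subrK. Qed.
HB.instance Definition _ :=
  GRing.isZmodMorphism.Build M (symAlg M) (@sym_var M) sym_var_is_zmod_morphism.

(** The composite and the identity are ring homomorphisms that agree on [sym_var x], by expanding
    [x] in the basis. So 2-torsion and divisibility by 2 in Sym(M) can be read off from integer
    coefficients. *)
Lemma sym_polyK : cancel sym_poly poly_sym.
Proof.
apply: (presented_uniq (f := poly_sym \o sym_poly) (g := idfun)) => x /=.
rewrite (sym_lift_var lin_form) /lin_form raddf_sum [in RHS](coordE x).
rewrite [RHS](raddf_sum (@sym_var M)); apply: eq_bigr => i _.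
rewrite (raddfMz poly_sym) [RHS](raddfMz (@sym_var M)).
by rewrite /= /poly_sym mmapX mmap1U.
Qed.

Lemma symAlg_double_eq0 (u : symAlg M) : u *~ 2 = 0 -> u = 0.
Proof.
move=> u2; rewrite -[u]sym_polyK.
suff -> : sym_poly u = 0 by rewrite raddf0.
apply/mpolyP => m; rewrite mcoeff0.
have /(congr1 (mcoeff m)) : sym_poly (u *~ 2) = 0 by rewrite u2 raddf0.
rewrite (raddfMz sym_poly) raddfMz mcoeff0 => /eqP.
by rewrite mulrzz mulf_eq0 orbF => /eqP.
Qed.

Lemma sym_poly_homog d (u : symAlg M) :
  u \in zspan (@sym_monomial d M) -> sym_poly u \is d.-homog.
Proof.
move=> /zspanP; elim=> [_ [s ->]||v w _ Hv _ Hw].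
- rewrite (sym_lift_prod lin_form).
  elim: d s => [|d IHd] s; first by rewrite tuple0 big_nil dhomog1.
  rewrite (tuple_eta s) big_cons; apply: (dhomogM (d := 1)); last exact: (IHd [tuple of behead s]).
  apply: rpred_sum => i _; apply: rpredMz => /=.
  by rewrite dhomogX /= mdeg1.
- by rewrite (raddf0 sym_poly) rpred0.
rewrite (raddfB sym_poly); apply: rpredB; [exact: Hv | exact: Hw].
Qed.

Lemma sym_monomial_mnm (m : 'X_{1..n}) :
  @sym_monomial (mdeg m) M (mmap1 (fun i => sym_var (b i)) m).
Proof.
pose s := flatten [seq nseq (m i) (b i) | i <- enum 'I_n].
have szs : size s == mdeg m.
  rewrite size_flatten /shape -map_comp mdegE sumnE big_map big_enum.
  by apply/eqP/eq_bigr => i _; rewrite /= size_nseq.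
exists (Tuple szs); rewrite /= big_flatten big_map big_enum.
by apply: eq_bigr => i _; rewrite big_nseq iter_mulr_1.
Qed.

(** Every coefficient of [sym_poly u] is even; the halved coefficients, on the same monomials in the
    basis, define [v]. *)
Lemma sym_monomials_even d (u : symAlg M) : u \in zspan (@sym_monomial d M) ->
    map_mpoly intr (sym_poly u) = 0 :> mpoly n 'F_2 ->
  exists2 v, v \in zspan (@sym_monomial d M) & u = v *~ 2.
Proof.
move=> /sym_poly_homog /dhomogP uH u0.
have even_coeff m : exists k : int, (sym_poly u)@_m == k *~ 2.
  have [|k kE] := @intr_F2_eq0 (sym_poly u)@_m; last by exists k; apply/eqP.
  by rewrite -(mcoeff_map_mpoly intr) u0 mcoeff0.
pose half m := xchoose (even_coeff m).
have halfE m : (sym_poly u)@_m = half m *~ 2 by exact/eqP/(xchooseP (even_coeff m)).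
exists (\sum_(m <- msupp (sym_poly u)) mmap1 (fun i => sym_var (b i)) m *~ half m).
  (* By homogeneity every monomial in the support has degree [d]. *)
  rewrite big_seq; apply: rpred_sum => m /uH <-; apply: rpredMz => /=.
  exact/zspanP/zspan_gen/sym_monomial_mnm.
rewrite -[LHS]sym_polyK /poly_sym /mmap mulrz_suml.
by apply: eq_bigr => m _; rewrite halfE mulrzl mulrzz mulrzA.
Qed.
End FreeSym.

(** * Functoriality of X, and its inclusion and projection maps *)

Lemma divPow_map_prod d (M N : zmodType) (f : {additive M -> N}) (s : seq (M * nat)) ds ds' :
  divPow_map d f (@div_prod d M s ds) = @div_prod d N [seq (f xn.1, xn.2) | xn <- s] ds'.
Proof.
apply: val_inj; rewrite /= big_map; apply: etrans (rmorph_prod (divAlg_map f) _ _ _) _.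
by apply: eq_bigr => x _; exact: divAlg_map_var.
Qed.

Lemma symPow_map_sym3 (M N : zmodType) (f : {additive M -> N}) x y z :
  symPow_map 3 f (sym3 x y z) = sym3 (f x) (f y) (f z).
Proof.
apply: val_inj; rewrite /= !big_cons !big_nil !mulr1.
by rewrite !(rmorphM (symAlg_map f)) !(symAlg_map_var f).
Qed.

(** An additive map sends each generator to a generator of the same kind. *)
Lemma X_subfunctor : is_subfunctor X_gen.
Proof.
move=> M N f; apply: zspan_stable_gen => _ [p|x|x y z|x y]; rewrite /= /dsum_map /=.
- by rewrite tensor_mapE raddf0; exact: X_sym.
- by rewrite raddf0 (@divPow_map_prod 3 M N f [:: (x, 3%N)] erefl erefl); exact: X_div3.
- by rewrite raddf0 (@divPow_map_prod 3 M N f [:: (x, 1%N); (y, 1%N); (z, 1%N)] erefl erefl); exact: X_div111.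
rewrite tensor_mapE (raddfD (symPow_map 3 f)) !symPow_map_sym3.
by rewrite (@divPow_map_prod 3 M N f [:: (x, 2%N); (y, 1%N)] erefl erefl); exact: X_div21.
Qed.

Local Notation X := (subF X_subfunctor).

Section Inclusion.
Variable M : fgFree.

Definition X_incl (u : symF 3 M) : X M := spanned_gen (X_sym (M := M) u).

Fact X_incl_is_zmod_morphism : zmod_morphism X_incl.
Proof.
by move=> u v; apply: val_inj; congr (_, _); [exact: raddfB | rewrite subr0].
Qed.
HB.instance Definition _ :=
  GRing.isZmodMorphism.Build (symF 3 M) (X M) X_incl X_incl_is_zmod_morphism.

Definition X_proj (v : X M) : divF 3 M := (spanned_val v).2.

Fact X_proj_is_zmod_morphism : zmod_morphism X_proj.
Proof. by []. Qed.
HB.instance Definition _ :=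
  GRing.isZmodMorphism.Build (X M) (divF 3 M) X_proj X_proj_is_zmod_morphism.
End Inclusion.

Fact X_incl_natural (M N : fgFree) (f : {additive M -> N}) (u : symF 3 M) :
  X_incl (fmap (symF 3) f u) = fmap X f (X_incl u).
Proof.
apply: val_inj => /=; rewrite /dsum_map /= tensor_mapE.
by rewrite (raddf0 (divPow_map 3 f)).
Qed.

Definition X_inclN : natTrans (symF 3) X := NatTrans X_incl_natural.

Fact X_proj_natural (M N : fgFree) (f : {additive M -> N}) (v : X M) :
  X_proj (fmap X f v) = fmap (divF 3) f (X_proj v).
Proof. by []. Qed.

Definition X_projN : natTrans X (divF 3) := NatTrans X_proj_natural.

(** * Surjectivity onto the third divided power *)

Lemma div_monomial3P (M : zmodType) (u : divAlg M) : div_monomial 3 u ->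
  [\/ exists x, u = div_var x 3,
      exists x y, u = div_var x 2 * div_var y 1
    | exists x y z, u = div_var x 1 * (div_var y 1 * div_var z 1)].
Proof.
move=> [s ds ->].
(* Factors x^[0] equal 1; without them the exponents form a composition of 3. *)
pose t := [seq xn <- s | (0 < xn.2)%N].
have dt : sumn [seq xn.2 | xn <- t] = 3%N.
  rewrite -ds /t !sumnE !big_map big_filter big_mkcond /=.
  by apply: eq_bigr => -[x [|n]].
have -> : \prod_(xn <- s) div_var xn.1 xn.2 = \prod_(xn <- t) div_var xn.1 xn.2.
  rewrite /t big_filter [RHS]big_mkcond /=.
  by apply: eq_bigr => -[x [|n]] //= _; rewrite div_var0.
have : all (fun xn : M * nat => (0 < xn.2)%N) t by exact: filter_all.
case: (t) dt => [|[x [|n]] [|[y [|m]] [|[z [|k]] r]]] //=.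
- rewrite addn0 => -[->] _; rewrite big_seq1; apply: Or31; by exists x.
- case: n m => [|[|n]] [|[|m]]; rewrite ?addn0 ?addSn ?addnS // => _ _.
  + rewrite !big_cons big_nil mulr1 /= mulrC; apply: Or32; by exists y, x.
  rewrite !big_cons big_nil mulr1 /=; apply: Or32; by exists x, y.
(* At least three positive exponents with sum 3: there are exactly three, each equal to 1. *)
case: n m k r => [|n] [|m] [|k] [|[w [|l]] r]; rewrite /= ?(addnS, addSn) // => _ _.
by rewrite !big_cons big_nil mulr1 /=; apply: Or33; exists x, y, z.
Qed.

(** Each divided power monomial of degree 3 is the second component of a generator of X(M). *)
Lemma X_proj_surj (M : fgFree) (w : divPow 3 M) :
  exists v : ambient M, v \in zspan (@X_gen M) /\ v.2 = w.
Proof.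
case: w => w wP.
have [v [vX vw]] : exists v : ambient M, v \in zspan (@X_gen M) /\ spanned_val v.2 = w.
  have : in_zspan (@div_monomial 3 M) w by exact/zspanP.
  elim=> [u /div_monomial3P|| u v _ [u' [uX <-]] _ [v' [vX <-]]].
  - case=> [[x ->]|[x [y ->]]|[x [y [z ->]]]].
    + eexists; split; first exact/zspanP/zspan_gen/(X_div3 x).
      by rewrite /= big_seq1.
    + eexists; split; first exact/zspanP/zspan_gen/(X_div21 x y).
      by rewrite /= !big_cons big_nil mulr1.
    eexists; split; first exact/zspanP/zspan_gen/(X_div111 x y z).
    by rewrite /= !big_cons big_nil mulr1.
  - by exists 0; split; [exact: rpred0 |].
  by exists (u' - v'); split; [apply: rpredB; [exact: uX | exact: vX] |].
by exists v; split=> //; exact: val_inj.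
Qed.

(** * Exactness *)

Lemma double_X_incl (M : fgFree) (u : symPow 3 M) :
  double_tensor (spanned_val (X_inclN M u)).1 = u *~ 2.
Proof. by apply: etrans (double_tensorE _ _) _; rewrite halfZ_double_one. Qed.

Lemma X_exact : short_exact X_inclN X_projN.
Proof.
move=> M; have [n [b bP]] := fg_basis M; split.
- move=> u v iuv.
  (* Equal images give 2u = 2v, and Sym(M) has no 2-torsion. *)
  have uv : u *~ 2 = v *~ 2 by rewrite -(double_X_incl u) -(double_X_incl v) iuv.
  apply/eqP; rewrite -subr_eq0; apply/eqP/val_inj.
  apply: (symAlg_double_eq0 bP); rewrite -(raddfMz (@spanned_val _ _)).
  by rewrite mulrzBl uv subrr.
- move=> v; split=> [v2|[u <-]]; last by [].
  have F2 : 2 \in [pchar (mpoly n 'F_2)].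
    apply/andP; split=> //; apply/eqP/mpolyP => m.
    by rewrite mcoeffMn mcoeff0 mulr2n; apply: pchar2_addrr; exact: pchar_Fp.
  (* With the coordinates modulo 2 as [h], the map [sym_lift h] is the reduction of [sym_poly]. *)
  pose h : {additive M -> mpoly n 'F_2} := map_mpoly intr \o lin_form bP.
  have := X_parity h F2 (spanned_valP v).
  have -> : (spanned_val v).2 = 0 by exact: v2.
  rewrite raddf0.
  have <- : map_mpoly intr (sym_poly bP (spanned_val (double_tensor (spanned_val v).1))) =
    sym_lift h (spanned_val (double_tensor (spanned_val v).1)).
    apply: (sym_lift_uniq (h := h) (f := map_mpoly intr \o sym_poly bP)) => x.
    by rewrite /= (sym_lift_var (lin_form bP)).
  (* The doubled first component is 0 modulo 2, hence equal to 2s with [s] in S^3(M). *)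
  move=> /(sym_monomials_even (spanned_valP _)) [s sS sE].
  exists (Spanned sS); apply: val_inj => /=.
  rewrite [RHS]surjective_pairing; congr (_, _); last exact: esym v2.
  (* The tensor of 1/2 with 2s is the tensor of 1 with [s]. *)
  rewrite -[RHS]half_tensorK -halfZ_half2 tens_mulrz; congr (tens _ _).
  by apply: val_inj; rewrite [RHS]sE; exact: (raddfMz (@spanned_val _ _)).
move=> w; have [v [vX vw]] := X_proj_surj w.
by exists (Spanned vX).
Qed.

(** * Nonsplitting, tested on Z^2 *)

Fact int2_basis : exists (n : nat) (b : 'I_n -> (int * int)%type),
  forall x, exists! a : {ffun 'I_n -> int}, x = \sum_i b i *~ a i.
Proof.
exists 2, (fun i => if i == 0 then (1, 0) else (0, 1)) => x.
have sumE (a : {ffun 'I_2 -> int}) :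
    \sum_i (if i == 0 then (1, 0) else (0, 1) : int * int) *~ a i = (a 0, a 1).
  rewrite !big_ord_recl big_ord0 /= addr0.
  have -> : lift ord0 ord0 = 1 :> 'I_2 by exact: val_inj.
  have pairMz (y : int * int) (m : int) : y *~ m = (y.1 * m, y.2 * m).
    by rewrite [LHS]surjective_pairing (raddfMz fst) (raddfMz snd) !mulrzz.
  by rewrite !pairMz /= !mul1r !mul0r; congr (_, _); rewrite /= ?addr0 ?add0r.
exists [ffun i => if i == 0 then x.1 else x.2]; split.
  by rewrite sumE !ffunE /=; case: (x).
move=> a ->; apply/ffunP => i; rewrite ffunE sumE /=.
by case: i => [[|[|i]] Hi] //=; congr (a _); exact: val_inj.
Qed.

Definition int2 : fgFree := FgFree int2_basis.

Definition neg_snd (x : int2) : int2 := (x.1, - x.2).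
Fact neg_snd_is_zmod_morphism : zmod_morphism neg_snd.
Proof. by move=> x y; congr (_, _); rewrite /= opprB opprK addrC. Qed.
HB.instance Definition _ :=
  GRing.isZmodMorphism.Build int2 int2 neg_snd neg_snd_is_zmod_morphism.

(** Dehomogenization: e_0 goes to 1 and e_1 to ['X], so on cubic forms the coefficient of ['X^2] is
    that of e_0 e_1^2. *)
Definition line_poly (x : int2) : {poly int} := x.1%:P + x.2%:P * 'X.
Fact line_poly_is_zmod_morphism : zmod_morphism line_poly.
Proof.
by move=> x y; rewrite /line_poly !polyCB mulrBl opprD addrACA.
Qed.
HB.instance Definition _ :=
  GRing.isZmodMorphism.Build int2 {poly int} line_poly line_poly_is_zmod_morphism.

Lemma sym_line_neg_snd (u : symAlg int2) :
  sym_lift line_poly (symAlg_map neg_snd u) = sym_lift line_poly u \Po (- 'X).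
Proof.
apply: (presented_uniq (f := sym_lift line_poly \o symAlg_map neg_snd)
  (g := comp_poly (- 'X) \o sym_lift line_poly)) => x.
rewrite /= [symAlg_map _ _](symAlg_map_var neg_snd) !(sym_lift_var line_poly).
rewrite /line_poly /neg_snd /= comp_polyD comp_polyM !comp_polyC comp_polyX.
by rewrite [LHS]/line_poly /neg_snd /= polyCN mulrN mulNr.
Qed.

Lemma coef2_comp_polyN (p : {poly int}) : (p \Po (- 'X))`_2 = p`_2.
Proof.
(* Writing [p] as a composition with ['X] lets the sums be compared termwise; only [i = 2]
   contributes, with sign (-1)^2. *)
rewrite -[p in RHS]comp_polyXr !coef_comp_poly; apply: eq_bigr => i _; congr (_ * _).
rewrite exprNn -polyC1 -polyCN -polyC_exp coefCM coefXn.
by case: eqP => [<-|_]; rewrite ?mulr0 // expr2 mulrNN mulr1 mul1r.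
Qed.

Lemma X_not_split : ~ splits X_projN.
Proof.
move=> [s sK].
pose e0 : int2 := (1, 0); pose e1 : int2 := (0, 1).
pose w : divPow 3 int2 := @div_prod 3 int2 [:: (e0, 2%N); (e1, 1%N)] erefl.
pose a := double_tensor (spanned_val (s int2 w)).1 : symPow 3 int2.
have w_neg : divPow_map 3 neg_snd w = - w.
  rewrite (@divPow_map_prod 3 int2 int2 neg_snd [:: (e0, 2%N); (e1, 1%N)] erefl erefl).
  apply: val_inj; rewrite /= !big_cons big_nil !mulr1 /=.
  have -> : neg_snd e0 = e0 by [].
  have -> : neg_snd e1 = e1 *~ (-1) by [].
  by rewrite div_varZ expr1 mulrN1z mulrN.
have a_neg : symPow_map 3 neg_snd a = - a.
  have sN : fmap X neg_snd (s int2 w) = - s int2 w.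
    by rewrite -(nat_comm s neg_snd w) -raddfN; congr (s int2 _); exact: w_neg.
  rewrite /a -double_tensor_map -raddfN; congr (double_tensor _).
  exact: (congr1 (fun v : X int2 => (spanned_val v).1) sN).
(* Negating e_1 preserves the coefficient of e_0 e_1^2 but turns [a] into its opposite, so this
   coefficient is its own negative. *)
have a2 : (sym_lift line_poly (spanned_val a))`_2 = 0.
  have := coef2_comp_polyN (sym_lift line_poly (spanned_val a)).
  rewrite -sym_line_neg_snd.
  have -> : symAlg_map neg_snd (spanned_val a) = - spanned_val a.
    exact: (congr1 (@spanned_val _ _) a_neg).
  rewrite (raddfN (sym_lift line_poly)) coefN => /eqP.
  by rewrite eq_sym -addr_eq0 -mulr2n -mulr_natr mulf_eq0 orbF => /eqP.
have F2 : 2 \in [pchar {poly 'F_2}].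
  apply/andP; split=> //; apply/eqP/polyP => i.
  by rewrite coefMn coef0 mulr2n; apply: pchar2_addrr; exact: pchar_Fp.
pose h : {additive int2 -> {poly 'F_2}} := map_poly intr \o line_poly.
have := X_parity h F2 (spanned_valP (s int2 w)).
have -> : (spanned_val (s int2 w)).2 = w by exact: (sK int2 w).
rewrite div_parity21.
have <- : map_poly intr (sym_lift line_poly (spanned_val a)) = sym_lift h (spanned_val a).
  apply: (sym_lift_uniq (h := h) (f := map_poly intr \o sym_lift line_poly)) => x.
  by rewrite /= (sym_lift_var line_poly).
(* The right-hand side is ['X + 'X^2] over ['F_2], with coefficient 1 at ['X^2], while the left has
   coefficient 0 there by [a2]. *)
move/(congr1 (fun p : {poly 'F_2} => p`_2)).
rewrite coef_map a2.
have -> : h e0 = 1 by rewrite /= /line_poly /= mul0r addr0 rmorph1.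
have -> : h e1 = 'X by rewrite /= /line_poly /= add0r mul1r map_polyX.
by rewrite !mul1r coefD -expr2 coefX coefXn.
Qed.

Theorem mainTheorem5 :
  exists X_sub : is_subfunctor X_gen,
  let X := subF X_sub in
  exists (i : natTrans (symF 3) X) (p : natTrans X (divF 3)),
    [/\ forall (M : fgFree) (u : symPow 3 M),
          spanned_val (i M u) = (tens halfZ_one u, 0%R),
        forall (M : fgFree) (v : X M), p M v = (spanned_val v).2,
        short_exact i p
      & ~ splits p].
Proof.
exists X_subfunctor; exists X_inclN; exists X_projN.
split; [by move=> M u | by move=> M v | exact: X_exact | exact: X_not_split].
Qed.
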